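(* Let $x_1,\ldots,x_n\in\mathbb{R}^d$ with $n\ge d+1$, and let $w_i>0$ with $\sum_{i=1}^n w_i=1$. For the same fixed $\nu_r>0$, $\mu_r\in\mathbb{R}^d$, $\Sigma_r\in\mathrm{SPD}(d)$, let $\mu_{r+1}\in\mathbb{R}^d$, $\Sigma_{r+1}\in\mathrm{SPD}(d)$ and $\nu_{r+1}^{\mathrm{aEM}},\nu_{r+1}^{\mathrm{MMF}},\nu_{r+1}^{\mathrm{GMMF}}>0$ be the updates given by one step of the algorithms aEM, MMF and GMMF described in the context, where for GMMF it is assumed that the inner loop converges. Then $$L(\nu_r,\mu_{r+1},\Sigma_{r+1})\ge L(\nu_{r+1}^{\mathrm{aEM}},\mu_{r+1},\Sigma_{r+1})\ge L(\nu_{r+1}^{\mathrm{MMF}},\mu_{r+1},\Sigma_{r+1})\ge L(\nu_{r+1}^{\mathrm{GMMF}},\mu_{r+1},\Sigma_{r+1}).$$ Equality holds true if and only if $\frac{\partial L}{\partial\nu}(\nu_r,\mu_{r+1},\Sigma_{r+1})=0$, and in this case $\nu_r=\nu_{r+1}^{\mathrm{aEM}}=\nu_{r+1}^{\mathrm{MMF}}=\nu_{r+1}^{\mathrm{GMMF}}$.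
   Context: $\mathrm{SPD}(d)$ is the set of symmetric positive definite real $d\times d$ matrices. The objective function is $$L(\nu,\mu,\Sigma)=-2\log\Gamma\left(\tfrac{d+\nu}{2}\right)+2\log\Gamma\left(\tfrac{\nu}{2}\right)-\nu\log(\nu)+(d+\nu)\sum_{i=1}^n w_i\log\left(\nu+(x_i-\mu)^{T}\Sigma^{-1}(x_i-\mu)\right)+\log|\Sigma|.$$ Let $\psi=\Gamma'/\Gamma$ be the digamma function and $\phi(x)=\psi(x)-\log(x)$, $x>0$. All three algorithms share the following step. Given $(\nu_r,\mu_r,\Sigma_r)$ put $\delta_{i,r}=(x_i-\mu_r)^{T}\Sigma_r^{-1}(x_i-\mu_r)$, $\gamma_{i,r}=\frac{\nu_r+d}{\nu_r+\delta_{i,r}}$, and $$\mu_{r+1}=\frac{\sum_{i=1}^n w_i\gamma_{i,r}x_i}{\sum_{i=1}^n w_i\gamma_{i,r}},\qquad \Sigma_{r+1}=\frac{\sum_{i=1}^n w_i\gamma_{i,r}(x_i-\mu_{r+1})(x_i-\mu_{r+1})^{T}}{\sum_{i=1}^n w_i\gamma_{i,r}},\qquad \delta_{i,r+1}=(x_i-\mu_{r+1})^{T}\Sigma_{r+1}^{-1}(x_i-\mu_{r+1}).$$ For $\nu>0$ set $F_b(\nu)=\sum_{i=1}^n w_i\left(\frac{\nu+d}{\nu+\delta_{i,r+1}}-\log\left(\frac{\nu+d}{\nu+\delta_{i,r+1}}\right)-1\right)$. The $\nu$-updates are: - aEM: $\nu_{r+1}^{\mathrm{aEM}}$ is the zero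 of $\nu\mapsto\phi(\frac{\nu}{2})-\phi(\frac{\nu_r+d}{2})+F_b(\nu_r)$. - MMF: $\nu_{r+1}^{\mathrm{MMF}}$ is the zero of $\nu\mapsto\phi(\frac{\nu}{2})-\phi(\frac{\nu+d}{2})+F_b(\nu_r)$. - GMMF: an inner loop is run with $\nu_{r,0}=\nu_r$ and, for $l=0,1,\ldots$, $\nu_{r,l+1}$ the zero of $\nu\mapsto\phi(\frac{\nu}{2})-\phi(\frac{\nu+d}{2})+F_b(\nu_{r,l})$; then $\nu_{r+1}^{\mathrm{GMMF}}=\lim_{l\to\infty}\nu_{r,l}\in\mathbb{R}_{>0}$. It is understood that these updates are defined: $\Sigma_{r+1}$ is positive definite and the zeros exist. *)

(* Defs.v *)
(* Points of R^d are column vectors, of type 'cV[R]_d. *)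
From HB Require Import structures.
From mathcomp Require Import all_boot all_order all_algebra.
From mathcomp Require Import all_classical all_reals all_analysis.
Set Implicit Arguments.
Unset Strict Implicit.
Unset Printing Implicit Defensive.
Import Order.TTheory GRing.Theory Num.Theory.
Import numFieldNormedType.Exports.
Local Open Scope classical_set_scope.
Local Open Scope ring_scope.

(* Euler's integral; it converges, hence is the Gamma function, for 0 < x. *)
Definition Gamma (R : realType) (x : R) : R :=
  \int[lebesgue_measure]_(t in `]0%R, +oo[) (t `^ (x - 1) * expR (- t)).

Definition digamma (R : realType) (x : R) : R := derive1 (@Gamma R) x / Gamma x.

Definition phi (R : realType) (x : R) : R := digamma x - ln x.

Definition spd (R : realType) (d : nat) (A : 'M[R]_d) : Prop :=
  A^T = A /\ forall v : 'cV[R]_d, v != 0 -> 0 < (v^T *m A *m v) 0 0.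

Definition delta (R : realType) (d : nat) (mu : 'cV[R]_d) (Sigma : 'M[R]_d)
    (y : 'cV[R]_d) : R :=
  ((y - mu)^T *m invmx Sigma *m (y - mu)) 0 0.

Definition objective (R : realType) (d n : nat) (w : 'I_n -> R)
    (x : 'I_n -> 'cV[R]_d) (nu : R) (mu : 'cV[R]_d) (Sigma : 'M[R]_d) : R :=
  - 2 * ln (Gamma ((d%:R + nu) / 2)) + 2 * ln (Gamma (nu / 2)) - nu * ln nu
  + (d%:R + nu) * (\sum_(i < n) w i * ln (nu + delta mu Sigma (x i)))
  + ln (\det Sigma).

Definition weight (R : realType) (d : nat) (nu : R) (mu : 'cV[R]_d)
    (Sigma : 'M[R]_d) (y : 'cV[R]_d) : R :=
  (nu + d%:R) / (nu + delta mu Sigma y).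

Definition mu_update (R : realType) (d n : nat) (w : 'I_n -> R)
    (x : 'I_n -> 'cV[R]_d) (nu : R) (mu : 'cV[R]_d) (Sigma : 'M[R]_d) :
    'cV[R]_d :=
  (\sum_(i < n) w i * weight nu mu Sigma (x i))^-1 *:
    (\sum_(i < n) (w i * weight nu mu Sigma (x i)) *: x i).

(* The scatter is centred at the updated location, but weighted by the
   current parameters. *)
Definition Sigma_update (R : realType) (d n : nat) (w : 'I_n -> R)
    (x : 'I_n -> 'cV[R]_d) (nu : R) (mu : 'cV[R]_d) (Sigma : 'M[R]_d) :
    'M[R]_d :=
  let mu' := mu_update w x nu mu Sigma in
  (\sum_(i < n) w i * weight nu mu Sigma (x i))^-1 *:
    (\sum_(i < n) (w i * weight nu mu Sigma (x i)) *:
       ((x i - mu') *m (x i - mu')^T)).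

(* The function F_b, to be taken at the updated location and scatter. *)
Definition Fb (R : realType) (d n : nat) (w : 'I_n -> R)
    (x : 'I_n -> 'cV[R]_d) (mu : 'cV[R]_d) (Sigma : 'M[R]_d) (nu : R) : R :=
  \sum_(i < n) w i *
    (weight nu mu Sigma (x i) - ln (weight nu mu Sigma (x i)) - 1).

Definition positive_zero (R : realType) (f : R -> R) (nu : R) : Prop :=
  0 < nu /\ f nu = 0.

(* In the next three predicates mu and Sigma are the updated location and
   scatter, and nu_r is the current number of degrees of freedom. *)
Definition aEM_update (R : realType) (d n : nat) (w : 'I_n -> R)
    (x : 'I_n -> 'cV[R]_d) (mu : 'cV[R]_d) (Sigma : 'M[R]_d)
    (nu_r nu' : R) : Prop :=
  positive_zero
    (fun nu => phi (nu / 2) - phi ((nu_r + d%:R) / 2) + Fb w x mu Sigma nu_r)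
    nu'.

Definition MMF_update (R : realType) (d n : nat) (w : 'I_n -> R)
    (x : 'I_n -> 'cV[R]_d) (mu : 'cV[R]_d) (Sigma : 'M[R]_d)
    (nu_r nu' : R) : Prop :=
  positive_zero
    (fun nu => phi (nu / 2) - phi ((nu + d%:R) / 2) + Fb w x mu Sigma nu_r)
    nu'.

Definition GMMF_update (R : realType) (d n : nat) (w : 'I_n -> R)
    (x : 'I_n -> 'cV[R]_d) (mu : 'cV[R]_d) (Sigma : 'M[R]_d)
    (nu_r nu' : R) : Prop :=
  exists u : nat -> R,
    [/\ u 0%N = nu_r,
        forall l : nat, MMF_update w x mu Sigma (u l) (u l.+1),
        u @ \oo --> nu' & 0 < nu'].

(* Main.v *)
Require Import Defs.
From mathcomp Require Import all_boot all_order all_algebra.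
From mathcomp Require Import all_classical all_reals all_analysis.
From mathcomp Require Import measurable_realfun ring lra.
Import Order.TTheory GRing.Theory Num.Theory.
Import numFieldNormedType.Exports.
Local Open Scope classical_set_scope.
Local Open Scope ring_scope.
Set Implicit Arguments.
Unset Strict Implicit.

(* With [mu] and [Sigma] fixed, the derivative of the objective in [nu] is
   [A + B], where [A nu = phi (nu / 2) - phi ((nu + d) / 2)] is negative and
   strictly increasing, and [B = F_b] is strictly decreasing unless all
   [delta_i] equal [d], in which case [B = 0] and the MMF update cannot exist.
   The MMF step solves [A nu' = - B nu]; if [A + B < 0] at [nu], then [nu < nu']
   and [A + B < 0] on [[nu, nu']], so the inner loop increases and the objective
   decreases strictly up to its limit. Since [phi] is increasing, the aEM update
   lies strictly between [nu] and the MMF update. The case [A + B > 0] is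
   symmetric, and [nu] is a fixed point of all the updates when [A + B = 0].

   The monotonicity of [phi] and [A] is read off
   [phi x = - \sum_k (1 / (x + k) - ln (1 + 1 / (x + k)))], which follows from
   the log-convexity of [Gamma] and [Gamma (x + 1) = x Gamma x]. *)

(** * Euler's integral: convergence, functional equation, positivity and log-convexity *)

Section GammaFunction.
Context {R : realType}.
Implicit Types (x t a b : R).
Local Notation mu := (@lebesgue_measure R).

Definition gamma_integrand x t : R := t `^ (x - 1) * expR (- t).

Lemma gamma_integrandE x t : 0 < t ->
  gamma_integrand x t = expR ((x - 1) * ln t - t).
Proof. by move=> t0; rewrite /gamma_integrand /powR gt_eqF// expRD. Qed.

Lemma gamma_integrand_ge0 x t : 0 <= gamma_integrand x t.
Proof. by rewrite mulr_ge0 ?powR_ge0 ?expR_ge0. Qed.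

Lemma measurable_gamma_integrand x (D : set R) :
  measurable_fun D (EFin \o gamma_integrand x).
Proof.
apply/measurable_EFinP/measurable_funTS/measurable_funM.
  exact: measurable_powR.
by apply: measurableT_comp; [exact: measurable_expR|exact: oppr_measurable].
Qed.

(** From [ln s <= s - 1] at [s = t / (2 * (x - 1))], half of the decay of [expR (- t)] absorbs the
    power of [t]; the final factor 2 in [C] cancels the rate of the exponential density. *)
Lemma gamma_integrand_ub x : 1 < x ->
  exists2 C : R, 0 <= C &
    forall t, 0 < t -> gamma_integrand x t <= C * exponential_pdf 2^-1 t.
Proof.
move=> x1; exists (expR ((x - 1) * ln (2 * (x - 1))) * 2).
  by rewrite mulr_ge0 ?expR_ge0.
move=> t t0; rewrite (exponential_pdfE _ (ltW t0)).
rewrite -mulrA (mulrA 2) mulfV ?mul1r ?pnatr_eq0//.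
rewrite gamma_integrandE// -expRD ler_expR.
have p0 : 0 < 2 * (x - 1) by lra.
have := le_ln1Dx (x := t / (2 * (x - 1)) - 1).
rewrite [1 + _]addrC subrK ltrBrDr addNr divr_gt0// => /(_ erefl).
rewrite ln_div ?posrE// -(ler_pM2l (x := x - 1)); last by lra.
rewrite !mulrBr [(x - 1) * (_ / _)](_ : _ = t / 2); first by lra.
by field; lra.
Qed.

Lemma integrable_gamma_integrand_gt1 x : 1 < x ->
  mu.-integrable `]0, +oo[ (EFin \o gamma_integrand x).
Proof.
move=> x1; have [C C0 leC] := gamma_integrand_ub x1.
have h : mu.-integrable `]0, +oo[
    (fun t => C%:E * (exponential_pdf 2^-1 t)%:E)%E.
  apply: integrableZl => //; apply: (integrableS measurableT) => //.
  by apply: integrable_exponential_pdf; rewrite invr_gt0.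
apply: le_integrable h => //; first exact: measurable_gamma_integrand.
move=> t /=; rewrite in_itv/= andbT => t0.
rewrite lee_fin ger0_norm ?gamma_integrand_ge0//.
exact: le_trans (leC _ t0) (ler_norm _).
Qed.

(** On a compact interval away from 0 no singularity of the power occurs; the boundary terms stay
    explicit so that their limit can be taken afterwards. *)
Lemma gamma_by_parts x a b : 0 < a -> a < b ->
  (\int[mu]_(t in `[a, b]) (gamma_integrand (x + 1) t)%:E =
   (a `^ x * expR (- a) - b `^ x * expR (- b))%:E +
   x%:E * \int[mu]_(t in `[a, b]) (gamma_integrand x t)%:E)%E.
Proof.
move=> a0 ab.
have dF t : 0 < t -> is_derive t 1 (fun t : R => t `^ x) (x * t `^ (x - 1)).
  by move=> t0; exact: is_derive1_powR.
have dG t : is_derive t 1 (fun t : R => - expR (- t)) (expR (- t)).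
  by apply: is_derive_eq; rewrite mulrN1 opprK.
have gt0 t : t \in `[a, b] -> 0 < t.
  by rewrite in_itv/= => /andP[+ _]; exact: lt_le_trans.
have gt0' t : t \in `]a, b[ -> 0 < t.
  by rewrite in_itv/= => /andP[+ _]; exact: lt_trans.
have dcont (f : R -> R) t l : is_derive t 1 f l -> {for t, continuous f}.
  by case=> + _; move/derivable1_diffP/differentiable_continuous.
have cF t : 0 < t -> {for t, continuous (fun t : R => t `^ x)}.
  by move=> /dF; exact: dcont.
have cG t : {for t, continuous (fun t : R => - expR (- t))}.
  exact: dcont (dG t).
have mcont (f : R -> R) : (forall t, 0 < t -> {for t, continuous f}) ->
    {within `[a, b], continuous f}.
  by move=> cf; apply: continuous_in_subspaceT => t /set_mem/= /gt0; exact: cf.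
have cf : {within `[a, b], continuous (fun t : R => x * t `^ (x - 1))}.
  apply: mcont => t t0; apply: continuousM; first exact: cst_continuous.
  exact: dcont (is_derive1_powR (x - 1) t0).
have cg : {within `[a, b], continuous (fun t : R => expR (- t))}.
  by apply: mcont => t _; apply: (dcont _ _ _ (_ : is_derive _ _ _ _)).
under eq_integral do rewrite /gamma_integrand addrK.
rewrite (@integration_by_parts R (fun t : R => t `^ x) (fun t : R => - expR (- t))
  (fun t : R => x * t `^ (x - 1)) (fun t : R => expR (- t)) a b)//.
- congr (_ + _)%E; first by congr (_%:E); ring.
  under eq_integral => t _ do
    rewrite mulrN -mulrA EFinN EFinM -mulNe -EFinN.
  rewrite integralZl//; last first.
    apply: continuous_compact_integrable; first exact: segment_compact.
    apply: mcont => t t0; apply: continuousM.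
      exact: dcont (is_derive1_powR (x - 1) t0).
    by apply: (dcont _ _ _ (_ : is_derive _ _ _ _)).
  by rewrite EFinN mulNe oppeK.
- split; last 2 first.
  + exact/cvg_at_right_filter/cF.
  + by apply/cvg_at_left_filter/cF; exact: lt_trans ab.
  + by move=> t /gt0' /dF [].
- by move=> t /gt0' /dF [? ?]; rewrite derive1E.
- split; last 2 first.
  + exact/cvg_at_right_filter/cG.
  + exact/cvg_at_left_filter/cG.
  + by move=> t _; case: (dG t).
- by move=> t _; case: (dG t) => ? ?; rewrite derive1E.
Qed.

Lemma gamma_integrand_cvgy x : 1 < x -> gamma_integrand x t @[t --> +oo] --> 0.
Proof.
move=> x1; have [C C0 leC] := gamma_integrand_ub x1.
apply: (@squeeze_cvgr _ _ _ _ (cst 0) (fun t => C * (2^-1 * expR (- (2^-1 * t))))).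
- near=> t; rewrite gamma_integrand_ge0/=.
  have t0 : 0 < t by near: t; exact: nbhs_pinfty_gt.
  by have := leC _ t0; rewrite (exponential_pdfE _ (ltW t0)) mulNr.
- exact: cvg_cst.
- rewrite -[X in _ --> X](mulr0 C); apply: cvgMr.
  rewrite -[X in _ --> X](mulr0 2^-1); apply: cvgMr.
  apply: (@cvg_comp _ _ _ _ (fun t => expR (- t)) _ (pinfty_nbhs R)).
    exact: gt0_cvgMry.
  exact: cvgr_expR.
Unshelve. all: by end_near. Qed.

Lemma gamma_boundary_cvg x : 0 < x ->
  (n.+2%:R^-1 `^ x * expR (- n.+2%:R^-1) - n.+2%:R `^ x * expR (- n.+2%:R) : R)
    @[n --> \oo] --> (0 : R).
Proof.
move=> x0; have cvg0 : (n.+2%:R^-1 : R) @[n --> \oo] --> (0 : R).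
  by have := @cvg_harmonic R; rewrite -cvg_shiftS.
rewrite -[X in _ --> X](subrr 0); apply: cvgB.
  rewrite -[X in _ --> X](mul0r (expR (- 0) : R)); apply: cvgM.
    have /cvg_at_rightP := powR_cvg0 x0.
    apply; split=> [n|]; first by rewrite invr_gt0.
    exact: cvg0.
  apply: (@cvg_comp _ _ _ (fun n => n.+2%:R^-1 : R) (fun t => expR (- t)) _ (nbhs 0)).
    exact: cvg0.
  apply: (@continuous_comp _ _ _ (fun t : R => - t) expR 0).
    exact: oppr_continuous.
  exact: continuous_expR.
(* The upper boundary term is the integrand with parameter [x + 1], which exceeds 1. *)
have /gamma_integrand_cvgy/cvg_pinftyP : 1 < x + 1 by rewrite ltrDr.
rewrite /gamma_integrand addrK; apply.
by have := @cvgr_idn R; rewrite -cvg_shiftS -cvg_shiftS.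
Qed.

(** Monotone convergence along the intervals [F n] passes to the limit in the integration by parts.
    Working in the extended reals allows this before finiteness is known; finiteness for small [x]
    is then deduced from it. *)
Lemma gamma_integral_rec x : 0 < x ->
  (\int[mu]_(t in `]0%R, +oo[) (gamma_integrand (x + 1) t)%:E =
   x%:E * \int[mu]_(t in `]0%R, +oo[) (gamma_integrand x t)%:E)%E.
Proof.
(* Starting at 2 makes the left endpoint strictly smaller than the right one for every [n]. *)
move=> x0; pose F n : set R := `[n.+2%:R^-1, n.+2%:R]%classic.
have nndF : nondecreasing_seq F.
  move=> m n mn; apply/subsetPset/subset_itv; rewrite bnd_simp.
    by rewrite lef_pV2 ?posrE// ler_nat.
  by rewrite ler_nat.
have -> : `]0%R, +oo[%classic = \bigcup_n F n.
  apply/seteqP; split => [t|t [n _]] /=; rewrite /F /= !in_itv/= ?andbT; last first.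
    by move=> /andP[+ _]; apply: lt_le_trans; rewrite invr_gt0.
  move=> t0; pose n := Num.truncn (t + t^-1).
  have nt : t + t^-1 < n.+1%:R by exact: truncnS_gt.
  have nn : n.+1%:R < n.+2%:R :> R by rewrite ltr_nat.
  exists n => //=; rewrite in_itv/= -[leLHS]/(_^-1) invf_ple ?posrE//.
  have : 0 < t^-1 by rewrite invr_gt0.
  by lra.
have cvgI y : (\int[mu]_(t in F n) (gamma_integrand y t)%:E)%E @[n --> \oo] -->
    (\int[mu]_(t in \bigcup_n F n) (gamma_integrand y t)%:E)%E.
  apply: ge0_nondecreasing_set_cvg_integral => //.
  - by move=> n; exact: measurable_itv.
  - by move=> n; exact: measurable_gamma_integrand.
  - by move=> n t _; rewrite lee_fin gamma_integrand_ge0.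
rewrite -(cvg_lim _ (cvgI (x + 1)))//; apply/cvg_lim => //.
have : (((n.+2%:R^-1 `^ x * expR (- n.+2%:R^-1) -
      n.+2%:R `^ x * expR (- n.+2%:R))%:E +
    x%:E * \int[mu]_(t in F n) (gamma_integrand x t)%:E) @[n --> \oo] -->
    0 + x%:E * \int[mu]_(t in \bigcup_n F n) (gamma_integrand x t)%:E)%E.
  apply: cvgeD.
  - by rewrite fin_num_adde_defr.
  - by apply: cvg_EFin; [exact: nearW|exact: gamma_boundary_cvg].
  - by apply: cvgeZl => //; exact: cvgI.
rewrite add0e; apply: cvg_trans; apply: near_eq_cvg; near=> n.
rewrite -gamma_by_parts ?invr_gt0//.
by apply: (@lt_trans _ _ 1); rewrite ?invf_lt1// ltr1n.
Unshelve. all: by end_near. Qed.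

(** The integral is finite at [x + 1 > 1], and by the recurrence an infinite value at [x] would make
    it infinite there too. *)
Lemma integrable_gamma_integrand x : 0 < x ->
  mu.-integrable `]0, +oo[ (EFin \o gamma_integrand x).
Proof.
move=> x0; have x1 : 1 < x + 1 by rewrite ltrDr.
have /integrableP[_] := integrable_gamma_integrand_gt1 x1.
under eq_integral do rewrite /= ger0_norm ?gamma_integrand_ge0//.
rewrite gamma_integral_rec// => h.
apply/integrableP; split; first exact: measurable_gamma_integrand.
under eq_integral do rewrite /= ger0_norm ?gamma_integrand_ge0//.
rewrite ltey; apply: contraPneq h => ->.
by rewrite gt0_muley ?lte_fin// ltxx.
Qed.

Lemma GammaE x : Gamma x = \int[mu]_(t in `]0, +oo[) gamma_integrand x t.
Proof. by []. Qed.

(** [Gamma] is [fine] of the extended integral, which would turn an infinite value into 0;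
    integrability excludes this. *)
Lemma Gamma_EFin x : 0 < x ->
  ((Gamma x)%:E = \int[mu]_(t in `]0%R, +oo[) (gamma_integrand x t)%:E)%E.
Proof.
move=> x0; rewrite fineK//.
by apply: integrable_fin_num => //; exact: integrable_gamma_integrand.
Qed.

Lemma GammaS x : 0 < x -> Gamma (x + 1) = x * Gamma x.
Proof.
move=> x0; apply: EFin_inj; rewrite EFinM !Gamma_EFin ?addr_gt0//.
exact: gamma_integral_rec.
Qed.

(** On []1, 2[], an interval of length 1, [0 <= ln t <= 1] and [t < 2], so the integrand is at least
    the positive constant [c]. *)
Lemma Gamma_gt0 x : 0 < x -> 0 < Gamma x.
Proof.
move=> x0; pose c : R := expR (- `|x - 1| - 2).
rewrite (@lt_le_trans _ _ c) ?expR_gt0// -lee_fin Gamma_EFin//.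
have -> : (c%:E = \int[mu]_(t in `]1%R, 2%R[) c%:E)%E.
  rewrite integral_cst//= lebesgue_measure_itv/= lte_fin ltr1n -EFinD.
  by rewrite (_ : 2 - 1 = 1) ?mule1//; lra.
have s12 : (`]1%R, 2%R[%classic : set R) `<=` `]0%R, +oo[%classic.
  by move=> t /=; rewrite !in_itv/= andbT => /andP[+ _]; apply: lt_trans.
apply: (@le_trans _ _ (\int[mu]_(t in `]1%R, 2%R[) (gamma_integrand x t)%:E)%E).
  apply: ge0_le_integral => //.
  - by move=> t _; rewrite lee_fin expR_ge0.
  - exact: measurable_gamma_integrand.
  move=> t /=; rewrite in_itv/= => /andP[t1 t2]; rewrite lee_fin.
  rewrite gamma_integrandE ?(lt_trans _ t1)// ler_expR.
  have lt0 : 0 <= ln t by rewrite ln_ge0// ltW.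
  have lt1 : ln t <= 1.
    by have := @le_ln1Dx _ (t - 1); rewrite [1 + _]addrC subrK; lra.
  have : - `|x - 1| <= (x - 1) * ln t.
    have := ler_norm (- (x - 1)); rewrite normrN.
    have := normr_ge0 (x - 1).
    by nra.
  by lra.
apply: ge0_subset_integral => //.
- exact: measurable_gamma_integrand.
- by move=> t _; rewrite lee_fin gamma_integrand_ge0.
Qed.

Lemma expR_convex (p q u v : R) : 0 <= p -> 0 <= q -> p + q = 1 ->
  expR (p * u + q * v) <= p * expR u + q * expR v.
Proof.
move=> p0 q0 pq; have p1 : p <= 1 by rewrite -pq lerDl.
have := @convex_expR R (Itv01 p0 p1) u v.
by rewrite !convRE/= (_ : unstable.onem p = q)// /unstable.onem -pq addrC addKr.
Qed.

(* Dividing the integrand by [Gamma a `^ p * Gamma b `^ q] turns the claim into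
   the convexity of the exponential, integrated. *)
Lemma ln_Gamma_convex a b (p q : R) : 0 < a -> 0 < b -> 0 <= p -> 0 <= q ->
  p + q = 1 ->
  ln (Gamma (p * a + q * b)) <= p * ln (Gamma a) + q * ln (Gamma b).
Proof.
move=> a0 b0 p0 q0 pq.
have z0 : 0 < p * a + q * b.
  have [p00|pn0] := eqVneq p 0.
    by move: pq; rewrite p00 mul0r !add0r => ->; rewrite mul1r.
  apply: ltr_pwDl; first by rewrite mulr_gt0// lt0r pn0.
  by rewrite mulr_ge0// ltW.
rewrite -ler_expR lnK ?posrE ?Gamma_gt0//.
have : Gamma b = expR (ln (Gamma b)) by rewrite lnK// posrE Gamma_gt0.
have : Gamma a = expR (ln (Gamma a)) by rewrite lnK// posrE Gamma_gt0.
move: (ln (Gamma a)) (ln (Gamma b)) => A B EA EB.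
have bound t : 0 < t -> gamma_integrand (p * a + q * b) t <=
    expR (p * A + q * B) * p * expR (- A) * gamma_integrand a t +
    expR (p * A + q * B) * q * expR (- B) * gamma_integrand b t.
  move=> t0; rewrite !gamma_integrandE//.
  have := @expR_convex p q ((a - 1) * ln t - t - A) ((b - 1) * ln t - t - B) p0 q0 pq.
  rewrite -(ler_pM2l (expR_gt0 (p * A + q * B))) -expRD => h.
  rewrite [X in expR X <= _](_ : _ = p * A + q * B +
    (p * ((a - 1) * ln t - t - A) + q * ((b - 1) * ln t - t - B))); last first.
    have -> : q = 1 - p by lra.
    ring.
  apply: (le_trans h); rewrite le_eqVlt; apply/orP; left; apply/eqP.
  rewrite (expRB _ A) (expRB _ B) (expRN A) (expRN B).
  by ring.
have iG x : 0 < x -> mu.-integrable `]0, +oo[ (EFin \o gamma_integrand x).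
  exact: integrable_gamma_integrand.
have iZ (k : R) x : 0 < x ->
    mu.-integrable `]0, +oo[ (EFin \o (fun t => k * gamma_integrand x t)).
  by move=> x0; apply: (integrableZl _ k (iG x x0)); exact: measurable_itv.
have : Gamma (p * a + q * b) <= \int[mu]_(t in `]0, +oo[)
    (expR (p * A + q * B) * p * expR (- A) * gamma_integrand a t +
     expR (p * A + q * B) * q * expR (- B) * gamma_integrand b t).
  rewrite GammaE; apply: le_Rintegral => //; first exact: iG.
    apply: (integrableD _ (iZ _ a a0) (iZ _ b b0)); exact: measurable_itv.
  by move=> t /=; rewrite in_itv/= andbT; exact: bound.
rewrite RintegralD//; [|exact: iZ..].
rewrite !RintegralZl//; [|exact: iG..].
rewrite -!GammaE EA EB -!mulrA -!expRD !addNr expR0 !mulr1 -mulrDr pq mulr1.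
exact.
Qed.

End GammaFunction.

(** * Convergence of the series that represents [- phi] *)

Section PhiSeries.
Context {R : realType}.
Implicit Types (x y : R).

(** This is [1 / y - ln (1 + 1 / y)], with the logarithm split so that partial sums telescope. *)
Definition phi_term y : R := y^-1 - (ln (y + 1) - ln y).

Lemma phi_term_ge0 y : 0 < y -> 0 <= phi_term y.
Proof.
move=> y0; rewrite /phi_term -ln_div ?posrE ?addr_gt0//.
rewrite mulrDl divff ?gt_eqF// mul1r subr_ge0 le_ln1Dx//.
by rewrite (lt_trans (ltrN10 _))// invr_gt0.
Qed.

(** [ln (y / (y + 1)) = ln (1 - 1 / (y + 1)) <= - 1 / (y + 1)]. The bound telescopes, which makes
    the series converge. *)
Lemma phi_term_le y : 0 < y -> phi_term y <= y^-1 - (y + 1)^-1.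
Proof.
move=> y0; rewrite lerD2l lerN2 -ln_div ?posrE ?addr_gt0//.
have y10 : 0 < y + 1 by rewrite addr_gt0.
rewrite -lerN2 -lnV ?posrE ?divr_gt0// invf_div.
have -> : y / (y + 1) = 1 + - (y + 1)^-1 by field; lra.
by rewrite le_ln1Dx// ltrN2 invf_lt1// ltrDr.
Qed.

Lemma sum_phi_term x n : 0 < x ->
  \sum_(k < n) phi_term (x + k%:R) =
  \sum_(k < n) (x + k%:R)^-1 - (ln (x + n%:R) - ln x).
Proof.
move=> x0; elim: n => [|n IHn]; first by rewrite !big_ord0 addr0 subrr subr0.
rewrite !big_ord_recr/= IHn /phi_term -natr1 (addrA x).
move: (\sum_(i < n) _) (ln _) (ln (x + n%:R)) (ln x) (_^-1) => a b c d e.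
by ring.
Qed.

Lemma sum_phi_term_le x n : 0 < x ->
  \sum_(k < n) phi_term (x + k%:R) <= x^-1 - (x + n%:R)^-1.
Proof.
move=> x0; elim: n => [|n IHn]; first by rewrite !big_ord0 addr0 subrr.
rewrite big_ord_recr/= -natr1 (addrA x).
have := @phi_term_le (x + n%:R); rewrite ltr_wpDr// => /(_ erefl) h.
by apply: (le_trans (lerD IHn h)); rewrite addrA subrK.
Qed.

Lemma nondecreasing_sum_phi_term x : 0 < x ->
  nondecreasing_seq (fun n => \sum_(k < n) phi_term (x + k%:R)).
Proof.
move=> x0; apply/nondecreasing_seqP => n.
by rewrite big_ord_recr/= lerDl phi_term_ge0// ltr_wpDr.
Qed.

(** For [0 < x] this limit exists and equals [- phi x], see [phiE]. *)
Definition phi_sum x : R := limn (fun n => \sum_(k < n) phi_term (x + k%:R)).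

Lemma cvg_phi_sum x : 0 < x ->
  \sum_(k < n) phi_term (x + k%:R) @[n --> \oo] --> phi_sum x.
Proof.
move=> x0; apply: nondecreasing_is_cvgn; first exact: nondecreasing_sum_phi_term.
exists x^-1 => _ [n _ <-]; apply: (le_trans (sum_phi_term_le _ x0)).
by rewrite lerBlDr lerDl invr_ge0 addr_ge0// ltW.
Qed.

End PhiSeries.

(** * Derivative of a convex solution of [f (x + 1) = f x + ln x] *)

Lemma is_derive_cvg (R : realType) (f : R -> R) (x l : R) :
  h^-1 * (f (h + x) - f x) @[h --> 0^'] --> l <-> is_derive x 1 f l.
Proof.
have E : (fun h : R => h^-1 *: ((f \o shift x) (h *: (1 : R)) - f x)) =
         (fun h => h^-1 * (f (h + x) - f x)).
  by apply/funext => h /=; rewrite /GRing.scale/= mulr1.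
split=> [H|[+ <-]]; last by rewrite /derivable /derive E.
apply: DeriveDef; first by rewrite /derivable E; apply: cvgP H.
by rewrite /derive E; apply: cvg_lim.
Qed.

(* The slopes of such an [f] at [x + N] are squeezed between the values of [ln]
   at [x + N - 1] and [x + N]; the recurrence transports this estimate to [x],
   which gives the differentiability of [f] for free. *)
Section BohrMollerup.
Context {R : realType}.
Implicit Types (x y a b c p q h : R).
Variable f : R -> R.
Hypothesis f_convex : forall a b p q, 0 < a -> 0 < b -> 0 <= p -> 0 <= q ->
  p + q = 1 -> f (p * a + q * b) <= p * f a + q * f b.
Hypothesis fS : forall x, 0 < x -> f (x + 1) = f x + ln x.

Lemma recurrence_addn x n : 0 < x ->
  f (x + n%:R) = f x + \sum_(k < n) ln (x + k%:R).
Proof.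
move=> x0; elim: n => [|n IHn]; first by rewrite big_ord0 !addr0.
rewrite big_ord_recr/= addrA -IHn -natr1 (addrA x) fS//.
exact: ltr_wpDr.
Qed.

(** Unnormalised weights keep convexity free of divisions, which leaves linear arithmetic to
    [slope_bounds]. *)
Lemma weighted_convex a b c p q :
  0 < a -> 0 < b -> 0 <= p -> 0 <= q -> 0 < p + q ->
  p * a + q * b = (p + q) * c ->
  (p + q) * f c <= p * f a + q * f b.
Proof.
move=> a0 b0 p0 q0 pq E; have pqn0 : p + q != 0 by rewrite gt_eqF.
have := @f_convex a b (p / (p + q)) (q / (p + q)) a0 b0.
move=> /(_ (divr_ge0 p0 (ltW pq)) (divr_ge0 q0 (ltW pq))).
rewrite -mulrDl divff// => /(_ erefl).
have -> : p / (p + q) * a + q / (p + q) * b = c.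
  by apply: (mulfI pqn0); rewrite -E; field.
rewrite -(ler_pM2l pq) => /le_trans; apply.
by rewrite le_eqVlt; apply/orP; left; apply/eqP; field.
Qed.

(** By convexity the slope lies between those over [[y - 1, y]] and [[y, y + 1]], which the
    recurrence evaluates to [ln (y - 1)] and [ln y]. *)
Lemma slope_bounds y h : 1 < y -> h != 0 -> `|h| < 1 ->
  ln (y - 1) <= h^-1 * (f (h + y) - f y) <= ln y.
Proof.
move=> y1 h0; rewrite ltr_norml => /andP[hN1 h1].
have y0 : 0 < y by lra.
have y10 : 0 < y - 1 by lra.
have yh0 : 0 < h + y by lra.
have y20 : 0 < y + 1 by lra.
have e1 := fS y0.
have e2 := fS y10; rewrite subrK in e2.
have [hn|hp|h00] := ltgtP h 0; last by rewrite h00 eqxx in h0.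
- rewrite ler_ndivlMl// ler_ndivrMl//.
  have := @weighted_convex (y + 1) (h + y) y (- h) 1 y20 yh0.
  have := @weighted_convex y (y - 1) (h + y) (1 + h) (- h) y0 y10.
  move: e1 e2; move: (f (y + 1)) (f y) (f (y - 1))
    (f (h + y)) (ln (y - 1)) (ln y) => A B C D E F -> -> c1 c2.
  have {}c1 := c1 ltac:(lra) ltac:(lra) ltac:(lra) ltac:(ring).
  have {}c2 := c2 ltac:(lra) ltac:(lra) ltac:(lra) ltac:(ring).
  by apply/andP; split; lra.
- rewrite ler_pdivlMl// ler_pdivrMl//.
  have := @weighted_convex (y - 1) (h + y) y h 1 y10 yh0.
  have := @weighted_convex y (y + 1) (h + y) (1 - h) h y0 y20.
  move: e1 e2; move: (f (y + 1)) (f y) (f (y - 1))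
    (f (h + y)) (ln (y - 1)) (ln y) => A B C D E F -> -> c1 c2.
  have {}c1 := c1 ltac:(lra) ltac:(lra) ltac:(lra) ltac:(ring).
  have {}c2 := c2 ltac:(lra) ltac:(lra) ltac:(lra) ltac:(ring).
  by apply/andP; split; lra.
Qed.

Lemma is_derive_convex_recurrence x : 0 < x ->
  is_derive x 1 f (ln x - phi_sum x).
Proof.
move=> x0; apply/is_derive_cvg/cvgrPdist_le => e e0.
have e30 : 0 < e / 3 by rewrite divr_gt0.
have /cvgrPdist_le/(_ _ e30) cvgS := cvg_phi_sum x0.
(* [N] is fixed before [h]. Three errors of size [e / 3] add up: the tail of the series, the gap
   between the slope bounds at [x + N], and the difference quotient of the finite sum of
   logarithms. *)
have [N [N1 N2 N3]] : exists N : nat, [/\ 1 < x + N%:R, (x + N%:R - 1)^-1 <= e / 3 &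
    `|phi_sum x - \sum_(k < N) phi_term (x + k%:R)| <= e / 3].
  near \oo => N; exists N.
  have NN : (e / 3)^-1 + 1 < N%:R by near: N; exact: nbhs_infty_gtr.
  have e3 : 0 < (e / 3)^-1 by rewrite invr_gt0.
  split; [by lra| |by near: N].
  by rewrite invf_ple ?posrE//; lra.
have dP : is_derive x 1 (fun y : R => \sum_(k < N) ln (y + k%:R))
    (\sum_(k < N) (x + k%:R)^-1).
  have -> : (fun y : R => \sum_(k < N) ln (y + k%:R)) =
      \sum_(k < N) (fun y : R => ln (y + k%:R)).
    by apply/funext => y; rewrite fct_sumE.
  apply: is_derive_sum => k.
  have xk : 0 < x + k%:R by rewrite ltr_wpDr.
  have dlnk := is_derive1_ln xk.
  by apply: is_derive_eq; rewrite addr0 mulr1.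
have /is_derive_cvg/cvgrPdist_le/(_ _ e30) cvgP := dP.
near=> h.
have hx1 : `|h| < Num.min x 1.
  near: h; apply: dnbhs0_lt; by rewrite lt_min x0 ltr01.
have hx : 0 < h + x.
  by move: hx1; rewrite lt_min ltr_norml => /andP[/andP[+ _] _]; lra.
have h1 : `|h| < 1 by move: hx1; rewrite lt_min => /andP[].
have h0 : h != 0 by near: h; exact: nbhs_dnbhs_neq.
have := slope_bounds N1 h0 h1.
have : `|\sum_(k < N) (x + k%:R)^-1 - h^-1 *
    (\sum_(k < N) ln (h + x + k%:R) - \sum_(k < N) ln (x + k%:R))| <= e / 3.
  by near: h.
rewrite (addrA h) !recurrence_addn//.
have : ln (x + N%:R) - ln (x + N%:R - 1) <= (x + N%:R - 1)^-1.
  have := @phi_term_ge0 _ (x + N%:R - 1); rewrite /phi_term subrK subr_gt0 subr_ge0.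
  exact.
move: N3; rewrite sum_phi_term//.
rewrite (_ : f (h + x) + _ - _ = (f (h + x) - f x) +
  (\sum_(k < N) ln (h + x + k%:R) - \sum_(k < N) ln (x + k%:R))); last first.
  by rewrite opprD addrACA.
rewrite (mulrDr _ (f (h + x) - f x)).
move: N2; rewrite !ler_norml.
move: (_^-1) (ln (x + N%:R)) (ln (x + N%:R - 1)) (phi_sum x) (ln x)
  (\sum_(k < N) (x + k%:R)^-1) (h^-1 * (f (h + x) - f x))
  (h^-1 * (_ - _)) => a b c d u v w z.
by move=> ? /andP[? ?] ? /andP[? ?] /andP[? ?]; apply/andP; split; lra.
Unshelve. all: by end_near. Qed.

End BohrMollerup.

(** * The series formula for [phi] *)

Section Digamma.
Context {R : realType}.
Implicit Types (x : R).

Lemma is_derive_ln_Gamma x : 0 < x ->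
  is_derive x 1 (fun y : R => ln (Gamma y)) (ln x - phi_sum x).
Proof.
apply: is_derive_convex_recurrence => [a b p q|y y0].
  exact: ln_Gamma_convex.
by rewrite GammaS// lnM ?posrE ?Gamma_gt0// addrC.
Qed.

Lemma phiE x : 0 < x -> phi x = - phi_sum x.
Proof.
move=> x0; rewrite /phi /digamma.
have dG : is_derive x 1 (@Gamma R) (Gamma x * (ln x - phi_sum x)).
  (* Only [ln (Gamma y)] is known to be differentiable; near [x], where [Gamma] is positive, its
     exponential gives [Gamma] back. *)
  apply: (@near_eq_is_derive _ _ _ (fun y => expR (ln (Gamma y)))).
    near=> y; rewrite lnK// posrE Gamma_gt0//.
    by near: y; exact: lt_nbhsr.
  have dlG := is_derive_ln_Gamma x0.
  apply: is_derive_eq; rewrite lnK ?posrE ?Gamma_gt0//.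
rewrite derive1E derive_val mulrAC divff ?gt_eqF ?Gamma_gt0// mul1r.
by rewrite addrAC subrr add0r.
Unshelve. all: by end_near. Qed.

End Digamma.

(** * Strict monotonicity of [phi] and of [phi x - phi (x + a)] *)

Section PhiMonotone.
Context {R : realType}.
Implicit Types (x y a s t : R).

Lemma MVT_closed (f df : R -> R) s t : s < t ->
  (forall c, s <= c <= t -> is_derive c 1 f (df c)) ->
  exists2 c, s < c < t & f t - f s = df c * (t - s).
Proof.
move=> st fdf; have [c|z|c cst ->] := @MVT R f df s t st.
- by rewrite in_itv/= => /andP[sc ct]; apply: fdf; rewrite !ltW.
- apply: derivable_within_continuous => c; rewrite in_itv/= => cst.
  by case: (fdf c cst).
- by exists c => //; rewrite in_itv/= in cst.
Qed.

Lemma is_derive_phi_term y : 0 < y ->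
  is_derive y 1 (@phi_term R) (- (y ^+ 2 * (y + 1))^-1).
Proof.
move=> y0; have y10 : 0 < y + 1 by rewrite addr_gt0.
have d1 := is_derive1_ln y0; have d2 := is_derive1_ln y10.
have d3 : is_derive y 1 (fun z : R => z^-1) (- y ^- 2).
  have := @is_deriveV R id y 1 1 (lt0r_neq0 y0) (is_derive_id _ _).
  by rewrite /GRing.scale/= mulr1.
rewrite /phi_term; apply: is_derive_eq.
by field; rewrite !gt_eqF.
Qed.

Lemma phi_term_decr x y : 0 < x -> x < y -> phi_term y < phi_term x.
Proof.
move=> x0 xy.
have [c /andP[xc _] E] := @MVT_closed (@phi_term R) _ x y xy
  (fun c h => is_derive_phi_term (lt_le_trans x0 (andP h).1)).
rewrite -subr_lt0 E pmulr_llt0 ?subr_gt0// oppr_lt0 invr_gt0.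
have c0 := lt_trans x0 xc.
by rewrite mulr_gt0 ?exprn_gt0 ?addr_gt0.
Qed.

(** The derivative [- 1 / (z ^ 2 * (z + 1))] of [phi_term] is smaller at [z] than at [z + a]. *)
Lemma phi_term_gap_decr x y a : 0 < a -> 0 < x -> x < y ->
  phi_term y - phi_term (y + a) < phi_term x - phi_term (x + a).
Proof.
move=> a0 x0 xy.
have [c|c /andP[xc _]] := @MVT_closed (fun z => phi_term z - phi_term (z + a))
  (fun z => - (z ^+ 2 * (z + 1))^-1 + ((z + a) ^+ 2 * (z + a + 1))^-1) x y xy.
  move=> /andP[xc _]; have c0 := lt_le_trans x0 xc.
  have d1 := is_derive_phi_term c0.
  have d2 := is_derive_phi_term (addr_gt0 c0 a0).
  by apply: is_derive_eq; rewrite addr0 mulr1 opprK.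
have c0 := lt_trans x0 xc; have ca0 := addr_gt0 c0 a0.
move=> E; rewrite -subr_lt0 E pmulr_llt0 ?subr_gt0// addrC subr_lt0.
rewrite ltf_pV2 ?posrE ?mulr_gt0 ?exprn_gt0 ?addr_gt0//.
by rewrite ltr_pM ?exprn_ge0 ?ltr_pXn2r ?nnegrE ?ltrD2r ?ltrDl// ltW// addr_gt0.
Qed.

(** Limits preserve only weak inequalities; strictness survives because the gap [v 0 - u 0] bounds
    the difference of all nonempty partial sums from below. *)
Lemma lt_lim_sum (u v : nat -> R) (U V : R) :
  \sum_(k < n) u k @[n --> \oo] --> U -> \sum_(k < n) v k @[n --> \oo] --> V ->
  (forall k, u k <= v k) -> u 0%N < v 0%N -> U < V.
Proof.
move=> cu cv uv uv0; rewrite -subr_gt0 (@lt_le_trans _ _ (v 0%N - u 0%N)) ?subr_gt0//.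
have H n : v 0%N - u 0%N <= \sum_(k < n.+1) v k - \sum_(k < n.+1) u k.
  rewrite -sumrB big_ord_recl lerDl.
  by apply: sumr_ge0 => k _; rewrite subr_ge0.
apply: (cvgr_to_ge (cvgB cv cu)); near=> n.
have n0 : (0 < n)%N by near: n; exact: nbhs_infty_gt.
by have := H n.-1; rewrite prednK.
Unshelve. all: by end_near. Qed.

Lemma phi_incr x y : 0 < x -> x < y -> phi x < phi y.
Proof.
move=> x0 xy; have y0 := lt_trans x0 xy.
rewrite !phiE// ltrN2; apply: (lt_lim_sum (u := fun k => phi_term (y + k%:R))
  (v := fun k => phi_term (x + k%:R)) (cvg_phi_sum y0) (cvg_phi_sum x0)).
  by move=> k; rewrite ltW// phi_term_decr ?ltrD2r ?ltr_wpDr.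
by rewrite /= !addr0 phi_term_decr.
Qed.

Lemma phi_shift_incr x y a : 0 < a -> 0 < x -> x < y ->
  phi x - phi (x + a) < phi y - phi (y + a).
Proof.
move=> a0 x0 xy; have y0 := lt_trans x0 xy.
have xa0 := addr_gt0 x0 a0; have ya0 := addr_gt0 y0 a0.
have cvgd z : 0 < z -> 0 < z + a ->
    \sum_(k < n) (phi_term (z + k%:R) - phi_term (z + k%:R + a)) @[n --> \oo] -->
    phi_sum z - phi_sum (z + a).
  move=> z0 za0; under eq_fun do rewrite sumrB.
  apply: cvgB; first exact: cvg_phi_sum.
  by under eq_fun do under eq_bigr do rewrite addrAC; exact: cvg_phi_sum.
rewrite !phiE// !opprK -ltrN2 !opprD !opprK.
apply: (lt_lim_sum (u := fun k => phi_term (y + k%:R) - phi_term (y + k%:R + a))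
  (v := fun k => phi_term (x + k%:R) - phi_term (x + k%:R + a))
  (cvgd _ y0 ya0) (cvgd _ x0 xa0)).
  by move=> k; rewrite ltW// phi_term_gap_decr ?ltrD2r ?ltr_wpDr.
by rewrite /= !addr0 phi_term_gap_decr.
Qed.

End PhiMonotone.

(** * The iteration [A (u k.+1) = - B (u k)] for increasing [A] and decreasing [B] *)

Section Iteration.
Context {R : realType}.
Implicit Types (s t x y : R).
Variables A B : R -> R.
Hypothesis A_incr : forall x y, 0 < x -> x < y -> A x < A y.
Hypothesis B_decr : forall x y, 0 < x -> x < y -> B y < B x.

Lemma pos_incr_lt x y : 0 < x -> 0 < y -> (A x < A y) = (x < y).
Proof.
move=> x0 y0; have [xy|yx|->] := ltgtP x y; last by rewrite ltxx.
  by rewrite A_incr.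
by apply: le_gtF; rewrite ltW// A_incr.
Qed.

Lemma pos_incr_inj x y : 0 < x -> 0 < y -> A x = A y -> x = y.
Proof.
move=> x0 y0 E; have [xy|yx|//] := ltgtP x y.
  by have := A_incr x0 xy; rewrite E ltxx.
by have := A_incr y0 yx; rewrite E ltxx.
Qed.

(** [A x < - B x = A y] gives [x < y]; for [x < t <= y], [A t + B t < A y + B x = 0]. *)
Lemma step_neg x y : 0 < x -> 0 < y -> A y + B x = 0 -> A x + B x < 0 ->
  x < y /\ forall t, x <= t <= y -> A t + B t < 0.
Proof.
move=> x0 y0 E h; have xy : x < y by rewrite -pos_incr_lt//; lra.
split=> // t /andP[xt ty]; have [<-//|xnt] := eqVneq x t.
have {}xt : x < t by rewrite lt_neqAle xnt.
have t0 := lt_trans x0 xt.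
have Aty : A t <= A y by rewrite leNgt pos_incr_lt// -leNgt.
by rewrite -E ler_ltD// B_decr.
Qed.

Lemma step_pos x y : 0 < x -> 0 < y -> A y + B x = 0 -> 0 < A x + B x ->
  y < x /\ forall t, y <= t <= x -> 0 < A t + B t.
Proof.
move=> x0 y0 E h; have yx : y < x by rewrite -pos_incr_lt//; lra.
split=> // t /andP[yt tx]; have [->//|xnt] := eqVneq t x.
have {}tx : t < x by rewrite lt_neqAle xnt.
have t0 := lt_le_trans y0 yt.
have Ayt : A y <= A t by rewrite leNgt pos_incr_lt// -leNgt.
by rewrite -E ler_ltD// B_decr.
Qed.

Variables (u : nat -> R) (l : R).
Hypothesis u0_gt0 : 0 < u 0%N.
Hypothesis u_step : forall k, 0 < u k.+1 /\ A (u k.+1) + B (u k) = 0.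
Hypothesis u_cvg : u @ \oo --> l.

Lemma iterates_gt0 k : 0 < u k.
Proof. by case: k => // k; case: (u_step k). Qed.

(** By induction: the steps [[u k, u k.+1]] cover the range from [u 0], and [step_neg] gives the
    sign on each of them. *)
Lemma iterates_neg k : A (u 0%N) + B (u 0%N) < 0 ->
  [/\ A (u k) + B (u k) < 0, u k < u k.+1 &
      forall t, u 0%N <= t <= u k -> A t + B t < 0].
Proof.
move=> h0; elim: k => [|k [hk uk IHk]].
  have [+ _] := step_neg (iterates_gt0 0) (iterates_gt0 1) (u_step 0).2 h0.
  by split=> // t; rewrite -eq_le => /eqP <-.
have [_ hS] := step_neg (iterates_gt0 k) (iterates_gt0 k.+1) (u_step k).2 hk.
have hk1 : A (u k.+1) + B (u k.+1) < 0 by apply: hS; rewrite lexx ltW.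
have [uk1 _] :=
  step_neg (iterates_gt0 k.+1) (iterates_gt0 k.+2) (u_step k.+1).2 hk1.
split=> // t /andP[u0t tuk]; have [tk|kt] := leP t (u k).
  by apply: IHk; rewrite u0t.
by apply: hS; rewrite tuk ltW.
Qed.

Lemma iterates_pos k : 0 < A (u 0%N) + B (u 0%N) ->
  [/\ 0 < A (u k) + B (u k), u k.+1 < u k &
      forall t, u k <= t <= u 0%N -> 0 < A t + B t].
Proof.
move=> h0; elim: k => [|k [hk uk IHk]].
  have [+ _] := step_pos (iterates_gt0 0) (iterates_gt0 1) (u_step 0).2 h0.
  by split=> // t; rewrite -eq_le => /eqP <-.
have [_ hS] := step_pos (iterates_gt0 k) (iterates_gt0 k.+1) (u_step k).2 hk.
have hk1 : 0 < A (u k.+1) + B (u k.+1) by apply: hS; rewrite lexx ltW.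
have [uk1 _] :=
  step_pos (iterates_gt0 k.+1) (iterates_gt0 k.+2) (u_step k.+1).2 hk1.
split=> // t /andP[ukt tu0]; have [tk|kt] := ltP t (u k).
  by apply: hS; rewrite ukt ltW.
by apply: IHk; rewrite kt.
Qed.

Lemma limit_neg : A (u 0%N) + B (u 0%N) < 0 ->
  u 1%N < l /\ forall t, u 0%N <= t -> t < l -> A t + B t < 0.
Proof.
move=> h0; have nd : nondecreasing_seq u.
  by apply/nondecreasing_seqP => k; have [_ /ltW] := iterates_neg k h0.
split.
  (* Strictness comes from one further iterate: [u 1 < u 2 <= l]. *)
  have [_ u12 _] := iterates_neg 1 h0; apply: (lt_le_trans u12).
  by rewrite -(cvg_lim _ u_cvg)//; apply: nondecreasing_cvgn_le => //; apply: cvgP u_cvg.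
move=> t u0t tl; have [k _ /(_ k (leqnn k))/= tk] := cvgr_gt _ u_cvg _ tl.
by have [_ _ ->//] := iterates_neg k h0; rewrite u0t ltW.
Qed.

Lemma limit_pos : 0 < A (u 0%N) + B (u 0%N) ->
  l < u 1%N /\ forall t, l < t -> t <= u 0%N -> 0 < A t + B t.
Proof.
move=> h0; have nd : nonincreasing_seq u.
  by apply/nonincreasing_seqP => k; have [_ /ltW] := iterates_pos k h0.
split.
  have [_ u12 _] := iterates_pos 1 h0; apply: (le_lt_trans _ u12).
  by rewrite -(cvg_lim _ u_cvg)//; apply: nonincreasing_cvgn_ge => //; apply: cvgP u_cvg.
move=> t tl u0t; have [k _ /(_ k (leqnn k))/= tk] := cvgr_lt _ u_cvg _ tl.
by have [_ _ ->//] := iterates_pos k h0; rewrite u0t ltW.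
Qed.

(** Injectivity of [A] makes [u] constant. *)
Lemma limit_fixed : A (u 0%N) + B (u 0%N) = 0 -> u 1%N = u 0%N /\ l = u 0%N.
Proof.
move=> h0; have uE k : u k = u 0%N.
  elim: k => // k IHk; have [uk1 Ek] := u_step k; rewrite IHk in Ek.
  by apply: pos_incr_inj => //; lra.
split; first exact: uE.
rewrite -(cvg_lim _ u_cvg)//; apply/cvg_lim => //.
by apply: cvg_near_cst; apply: nearW => k; rewrite uE.
Qed.

End Iteration.

(** * Invertibility of positive definite matrices and the sign of [delta] *)

Lemma spd_unitmx (R : realType) (d : nat) (A : 'M[R]_d) : spd A -> A \in unitmx.
Proof.
move=> [_ pos]; rewrite unitmxE unitfE; apply/negP => /det0P[v v0 vA].
have := pos v^T; rewrite trmxK vA mul0mx mxE ltxx => /(_ _)/notF; apply.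
by apply: contra_neq v0 => /(congr1 trmx); rewrite trmxK trmx0.
Qed.

Lemma delta_ge0 (R : realType) (d : nat) (mu : 'cV[R]_d) (Sigma : 'M[R]_d)
  (y : 'cV[R]_d) : spd Sigma -> 0 <= delta mu Sigma y.
Proof.
move=> Sspd; have Su := spd_unitmx Sspd; have [ST pos] := Sspd.
rewrite /delta; set z := y - mu.
(* Substituting [v = invmx Sigma *m z] turns the form of the inverse into that of [Sigma], whose
   positivity is given. *)
have -> : z^T *m invmx Sigma *m z =
    (invmx Sigma *m z)^T *m Sigma *m (invmx Sigma *m z).
  by rewrite trmx_mul trmx_inv ST -!mulmxA mulKVmx.
have [->|v0] := eqVneq (invmx Sigma *m z) 0; first by rewrite mulmx0 mxE.
exact/ltW/pos.
Qed.

(** * Monotonicity of one summand of [Fb] *)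

Section Summand.
Context {R : realType}.
Implicit Types (D delta x y : R).

Definition fb_term D delta x : R :=
  (x + D) / (x + delta) - ln ((x + D) / (x + delta)) - 1.

(** With [s = (x + D) / (x + delta)], both [s'] and [1 - 1 / s] contain the factor [delta - D] up to
    sign, hence the square and a sign independent of [delta]. *)
Lemma is_derive_fb_term D delta x : 0 < D -> 0 <= delta -> 0 < x ->
  is_derive x 1 (fb_term D delta)
    (- ((delta - D) ^+ 2 / ((x + D) * (x + delta) ^+ 2))).
Proof.
move=> D0 delta0 x0.
have xD : 0 < x + D by rewrite addr_gt0.
have xd : 0 < x + delta by rewrite ltr_pwDl.
have d1 : is_derive x 1 (fun y : R => (y + delta)^-1) (- (x + delta) ^- 2).
  have d0 : is_derive x 1 (fun y : R => y + delta) 1.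
    by apply: is_derive_eq; rewrite addr0.
  have := @is_deriveV R (fun y => y + delta) x 1 1 (lt0r_neq0 xd) d0.
  by rewrite /GRing.scale/= mulr1.
have d2 : is_derive x 1 (fun y : R => (y + D) / (y + delta))
   ((delta - D) / (x + delta) ^+ 2).
  apply: is_derive_eq; rewrite /GRing.scale/=; by field; lra.
have d3 := is_derive1_ln (divr_gt0 xD xd).
rewrite /fb_term; apply: is_derive_eq.
by field; lra.
Qed.

Lemma fb_term_decr D delta x y : 0 < D -> 0 <= delta -> delta != D ->
  0 < x -> x < y -> fb_term D delta y < fb_term D delta x.
Proof.
move=> D0 delta0 dD x0 xy.
have [c|c /andP[xc _] E] := @MVT_closed R (fb_term D delta)
  (fun x => - ((delta - D) ^+ 2 / ((x + D) * (x + delta) ^+ 2))) x y xy.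
  by move=> /andP[xc _]; apply: is_derive_fb_term => //; exact: lt_le_trans xc.
have c0 := lt_trans x0 xc.
rewrite -subr_lt0 E pmulr_llt0 ?subr_gt0// oppr_lt0 divr_gt0//.
  by rewrite lt0r sqr_ge0 expf_neq0// subr_eq0.
by rewrite mulr_gt0 ?exprn_gt0// ltr_pwDl// ltW.
Qed.

Lemma fb_term_fixed D x : 0 < D -> 0 < x -> fb_term D D x = 0.
Proof.
move=> D0 x0; rewrite /fb_term divff ?ln1 ?subr0 ?subrr//.
by rewrite gt_eqF ?addr_gt0.
Qed.

End Summand.

(** * The derivative of the objective in [nu] and the monotonicity of its two parts *)

Section Objective.
Context {R : realType}.
Variables (d n : nat) (d_gt0 : (0 < d)%N) (x : 'I_n -> 'cV[R]_d) (w : 'I_n -> R).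
Hypotheses (w_gt0 : forall i, 0 < w i) (w_sum1 : \sum_(i < n) w i = 1).
Variables (mu : 'cV[R]_d) (Sigma : 'M[R]_d).
Hypothesis Sigma_spd : spd Sigma.
Implicit Types nu : R.

Let D0 : 0 < d%:R :> R. Proof. by rewrite ltr0n. Qed.
Let dge i : 0 <= delta mu Sigma (x i). Proof. exact: delta_ge0. Qed.

Definition phi_gap nu : R := phi (nu / 2) - phi ((nu + d%:R) / 2).

Lemma phi_gap_lt0 nu : 0 < nu -> phi_gap nu < 0.
Proof.
move=> nu0; rewrite subr_lt0 phi_incr ?divr_gt0//.
by rewrite ltr_pM2r ?invr_gt0// ltrDl.
Qed.

Lemma phi_gap_incr nu nu' : 0 < nu -> nu < nu' -> phi_gap nu < phi_gap nu'.
Proof.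
move=> nu0 nn; rewrite /phi_gap !mulrDl phi_shift_incr ?divr_gt0//.
by rewrite ltr_pM2r ?invr_gt0.
Qed.

(** The summand [i] decreases strictly; each other one decreases too, or vanishes when its [delta]
    is [d]. *)
Lemma Fb_decr nu nu' : (exists i, delta mu Sigma (x i) != d%:R) ->
  0 < nu -> nu < nu' -> Fb w x mu Sigma nu' < Fb w x mu Sigma nu.
Proof.
move=> [i di] nu0 nn; rewrite /Fb (bigD1 i)//= [ltRHS](bigD1 i)//=.
apply: ltr_leD; first by rewrite ltr_pM2l//; exact: fb_term_decr.
apply: ler_sum => j _; rewrite ler_pM2l//.
have [E|dj] := eqVneq (delta mu Sigma (x j)) d%:R; last first.
  by apply/ltW/fb_term_decr.
rewrite /weight E -!/(fb_term _ _ _) !fb_term_fixed//.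
exact: lt_trans nn.
Qed.

Lemma Fb_eq0 nu : (forall i, delta mu Sigma (x i) = d%:R) -> 0 < nu ->
  Fb w x mu Sigma nu = 0.
Proof.
move=> dE nu0; apply: big1 => i _; rewrite /weight dE -/(fb_term _ _ _).
by rewrite fb_term_fixed// mulr0.
Qed.

Lemma is_derive_objective nu : 0 < nu ->
  is_derive nu 1 (fun nu => objective w x nu mu Sigma)
    (phi_gap nu + Fb w x mu Sigma nu).
Proof.
move=> nu0; have dn0 : 0 < d%:R + nu by rewrite addr_gt0.
have n2 : 0 < nu / 2 by rewrite divr_gt0.
have dn2 : 0 < (d%:R + nu) / 2 by rewrite divr_gt0.
have nd i : 0 < nu + delta mu Sigma (x i) by rewrite ltr_pwDl.
have d1 := is_derive_ln_Gamma n2.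
have d2 := is_derive_ln_Gamma dn2.
have e1 : is_derive nu 1 (fun nu : R => ln (Gamma (nu / 2)))
    ((ln (nu / 2) + phi (nu / 2)) / 2).
  have h : is_derive nu 1 (fun nu : R => nu / 2) 2^-1.
    by apply: is_derive_eq; rewrite /GRing.scale/=; ring.
  by have := @is_derive1_comp R (fun y => ln (Gamma y)) (fun y => y / 2) nu _ _ d1 h;
    rewrite phiE.
have e2 : is_derive nu 1 (fun nu : R => ln (Gamma ((d%:R + nu) / 2)))
    ((ln ((d%:R + nu) / 2) + phi ((d%:R + nu) / 2)) / 2).
  have h : is_derive nu 1 (fun nu : R => (d%:R + nu) / 2) 2^-1.
    by apply: is_derive_eq; rewrite /GRing.scale/=; ring.
  by have := @is_derive1_comp R (fun y => ln (Gamma y)) (fun y => (d%:R + y) / 2)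
    nu _ _ d2 h; rewrite phiE.
have e3 : is_derive nu 1
    (fun nu : R => \sum_(i < n) w i * ln (nu + delta mu Sigma (x i)))
    (\sum_(i < n) w i / (nu + delta mu Sigma (x i))).
  have -> : (fun nu : R => \sum_(i < n) w i * ln (nu + delta mu Sigma (x i))) =
      \sum_(i < n) (fun nu : R => w i * ln (nu + delta mu Sigma (x i))).
    by apply/funext => y; rewrite fct_sumE.
  apply: is_derive_sum => i.
  have dlni := is_derive1_ln (nd i).
  by apply: is_derive_eq; rewrite /GRing.scale/=; ring.
have e4 := is_derive1_ln nu0.
rewrite /objective; apply: is_derive_eq.
rewrite /GRing.scale/=.
(* Since the weights sum to 1, [ln (nu + d)] and 1 leave the sum; in the derivative the [ln nu] and
   [ln 2] terms then cancel. *)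
have -> : Fb w x mu Sigma nu = (nu + d%:R) * (\sum_(i < n) w i / (nu + delta mu Sigma (x i)))
   + \sum_(i < n) w i * ln (nu + delta mu Sigma (x i)) - ln (nu + d%:R) - 1.
  transitivity ((nu + d%:R) * (\sum_(i < n) w i / (nu + delta mu Sigma (x i)))
   + \sum_(i < n) w i * ln (nu + delta mu Sigma (x i))
   - ln (nu + d%:R) * \sum_(i < n) w i - \sum_(i < n) w i); last first.
    by rewrite w_sum1 mulr1.
  rewrite !mulr_sumr -big_split/= -!sumrB/=; apply: eq_bigr => i _.
  rewrite /weight ln_div ?posrE//; last by rewrite addrC.
  by ring.
rewrite /phi_gap !ln_div ?posrE// (addrC d%:R).
rewrite divff ?gt_eqF//.
move: (phi (nu / 2)) (phi ((nu + d%:R) / 2)) (ln (nu + d%:R)) (ln nu) (ln 2)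
  (\sum_(i < n) w i / (nu + delta mu Sigma (x i)))
  (\sum_(i < n) w i * ln (nu + delta mu Sigma (x i))) => a b c e f g h.
by field.
Qed.

End Objective.

(** * Comparison of the updates by the sign of the derivative at [nu_r] *)

Theorem corollary5p4 (R : realType) (d n : nat) (d_gt0 : (0 < d)%N)
    (n_ge : (d + 1 <= n)%N)
    (x : 'I_n -> 'cV[R]_d) (w : 'I_n -> R)
    (w_gt0 : forall i : 'I_n, 0 < w i) (w_sum1 : \sum_(i < n) w i = 1)
    (nu_r : R) (mu_r : 'cV[R]_d) (Sigma_r : 'M[R]_d)
    (nu_r_gt0 : 0 < nu_r) (Sigma_r_spd : spd Sigma_r)
    (mu_r1 : 'cV[R]_d) (Sigma_r1 : 'M[R]_d)
    (mu_r1E : mu_r1 = mu_update w x nu_r mu_r Sigma_r)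
    (Sigma_r1E : Sigma_r1 = Sigma_update w x nu_r mu_r Sigma_r)
    (Sigma_r1_spd : spd Sigma_r1)
    (nu_aEM nu_MMF nu_GMMF : R)
    (h_aEM : aEM_update w x mu_r1 Sigma_r1 nu_r nu_aEM)
    (h_MMF : MMF_update w x mu_r1 Sigma_r1 nu_r nu_MMF)
    (h_GMMF : GMMF_update w x mu_r1 Sigma_r1 nu_r nu_GMMF) :
  let L := fun nu : R => objective w x nu mu_r1 Sigma_r1 in
  [/\ L nu_r >= L nu_aEM, L nu_aEM >= L nu_MMF & L nu_MMF >= L nu_GMMF] /\
  [/\ L nu_r = L nu_aEM <-> derive1 L nu_r = 0,
      L nu_aEM = L nu_MMF <-> derive1 L nu_r = 0 &
      L nu_MMF = L nu_GMMF <-> derive1 L nu_r = 0] /\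
  (derive1 L nu_r = 0 -> [/\ nu_r = nu_aEM, nu_aEM = nu_MMF & nu_MMF = nu_GMMF]).
Proof.
move=> L.
pose A := @phi_gap R d; pose B := Fb w x mu_r1 Sigma_r1.
have dL (c : R) : 0 < c -> is_derive c 1 L (A c + B c) by exact: is_derive_objective.
have A_incr (y z : R) : 0 < y -> y < z -> A y < A z by exact: phi_gap_incr.
have [a0 aE] := h_aEM; have [M0 ME] := h_MMF.
have [u [u0 us uc G0]] := h_GMMF.
have {}aE : phi (nu_aEM / 2) = phi ((nu_r + d%:R) / 2) - B nu_r.
  by move: aE; rewrite -/(B _); lra.
have {}ME : A nu_MMF + B nu_r = 0 by [].
(* If every [delta i] were [d], then [B] would vanish, but [A < 0]. *)
have /existsP nd : [exists i, delta mu_r1 Sigma_r1 (x i) != d%:R].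
  rewrite -negb_forall; apply/negP => /forallP dE.
  have B0 : B nu_r = 0 by apply: Fb_eq0 => // i; apply/eqP.
  have AM : phi_gap d nu_MMF = 0 by rewrite -ME B0 addr0.
  by have := phi_gap_lt0 d_gt0 M0; rewrite AM ltxx.
have B_decr (y z : R) : 0 < y -> y < z -> B z < B y by exact: Fb_decr.
have u0_gt0 : 0 < u 0%N by rewrite u0.
have u_step k : 0 < u k.+1 /\ A (u k.+1) + B (u k) = 0 by exact: us.
have AE (y : R) : A y = phi (y / 2) - phi ((y + d%:R) / 2) by [].
clearbody A B L.
(* The first inner iterate and the MMF update solve the same equation, and [A] is injective. *)
have u1 : u 1%N = nu_MMF.
  have [u1_gt0 u1E] := u_step 0; apply: (pos_incr_inj A_incr) => //.
  by rewrite u0 in u1E; lra.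
have half (y z : R) : y / 2 < z / 2 -> y < z by lra.
have phi_lt (y z : R) : 0 < y -> 0 < z -> phi y < phi z -> y < z.
  by move=> y0 z0; rewrite (pos_incr_lt (@phi_incr R) y0 z0).
have EM : phi (nu_MMF / 2) = phi ((nu_MMF + d%:R) / 2) - B nu_r.
  by move: ME; rewrite AE; lra.
have Er : phi (nu_r / 2) = phi ((nu_r + d%:R) / 2) + A nu_r.
  by rewrite AE; lra.
have dr0 : 0 < nu_r + d%:R by rewrite addr_gt0// ltr0n.
have dM0 : 0 < nu_MMF + d%:R by rewrite addr_gt0// ltr0n.
have -> : derive1 L nu_r = A nu_r + B nu_r by rewrite derive1E; case: (dL _ nu_r_gt0).
have [hn|hp|h0] := ltgtP (A nu_r + B nu_r) 0.
- have [|MG hG] := limit_neg A_incr B_decr u0_gt0 u_step uc; first by rewrite u0.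
  rewrite u1 u0 in MG hG.
  have [rM _] := step_neg A_incr B_decr nu_r_gt0 M0 ME hn.
  (* [phi (nu_aEM / 2) - phi (nu_r / 2) = - (A nu_r + B nu_r)]. *)
  have ra : nu_r < nu_aEM.
    by apply/half/phi_lt; rewrite ?divr_gt0// aE Er; lra.
  (* The two defining equations differ only in [phi ((nu_MMF + d) / 2)] against
     [phi ((nu_r + d) / 2)], and [nu_r < nu_MMF]. *)
  have aM : nu_aEM < nu_MMF.
    apply/half/phi_lt; rewrite ?divr_gt0// aE EM ltrD2r phi_incr ?divr_gt0//.
    by lra.
  (* The sign of [A + B] is known only before [nu_GMMF]; the mean value point is interior, so
     [t = nu_GMMF] is allowed. *)
  have Ldec (s t : R) : nu_r <= s -> s < t -> t <= nu_GMMF -> L t < L s.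
    move=> rs st tG.
    have [c|c /andP[sc ct] E] := @MVT_closed R L (fun c => A c + B c) s t st.
      by move=> /andP[sc _]; apply: dL; apply: lt_le_trans sc; apply: lt_le_trans rs.
    rewrite -subr_lt0 E pmulr_llt0 ?subr_gt0//.
    apply: hG; first exact: le_trans rs (ltW sc).
    exact: lt_le_trans tG.
  have L1 : L nu_aEM < L nu_r by apply: Ldec; lra.
  have L2 : L nu_MMF < L nu_aEM by apply: Ldec; lra.
  have L3 : L nu_GMMF < L nu_MMF by apply: Ldec; lra.
  (* All inequalities are strict and the derivative is nonzero, so both sides of each equivalence
     are false. *)
  by split; [split; exact: ltW|split; [split; split|]]; lra.
- have [|MG hG] := limit_pos A_incr B_decr u0_gt0 u_step uc; first by rewrite u0.
  rewrite u1 u0 in MG hG.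
  have [Mr _] := step_pos A_incr B_decr nu_r_gt0 M0 ME hp.
  have ar : nu_aEM < nu_r.
    by apply/half/phi_lt; rewrite ?divr_gt0// aE Er; lra.
  have Ma : nu_MMF < nu_aEM.
    apply/half/phi_lt; rewrite ?divr_gt0// aE EM ltrD2r phi_incr ?divr_gt0//.
    by lra.
  have Linc (s t : R) : nu_GMMF <= s -> s < t -> t <= nu_r -> L s < L t.
    move=> Gs st tr.
    have [c|c /andP[sc ct] E] := @MVT_closed R L (fun c => A c + B c) s t st.
      by move=> /andP[sc _]; apply: dL; apply: lt_le_trans sc; apply: lt_le_trans Gs.
    rewrite -subr_gt0 E pmulr_lgt0 ?subr_gt0//.
    apply: hG; first exact: le_lt_trans sc.
    exact: le_trans (ltW ct) tr.
  have L1 : L nu_aEM < L nu_r by apply: Linc; lra.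
  have L2 : L nu_MMF < L nu_aEM by apply: Linc; lra.
  have L3 : L nu_GMMF < L nu_MMF by apply: Linc; lra.
  by split; [split; exact: ltW|split; [split; split|]]; lra.
(* Here [nu_r] itself solves the aEM and MMF equations; injectivity of [phi] and [A] identifies all
   the updates with it. *)
- have [|uE GE] := limit_fixed A_incr u0_gt0 u_step uc; first by rewrite u0.
  rewrite u1 u0 in uE GE.
  have ra : nu_r = nu_aEM.
    suff : nu_r / 2 = nu_aEM / 2 by lra.
    apply: (pos_incr_inj (@phi_incr R)); rewrite ?divr_gt0// aE Er.
    by lra.
  by rewrite GE uE -ra; split; [|split].
Qed.
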